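(* Let $G$ be a finite complete group, let $g\in G$ be an involution, let $\sigma(g)$ be the inner automorphism $h\mapsto ghg^{-1}$, and let $S\subseteq G$ be a generalized Cayley subset of $G$ induced by $\sigma(g)$. Then for any $x\in\Omega_{\sigma(g)}(G)$, $$GC(G,S,\sigma(g))\cong GC(G,xSx,\sigma(g)),$$ where $xSx=\{xsx\mid s\in S\}$ and $\cong$ denotes graph isomorphism.
   Context: A group $G$ is complete if $Z(G)=\{e\}$ and $\mathrm{Aut}(G)=\mathrm{Inn}(G)$. An involution is an element of order $2$. For $y\in G$ and $\alpha\in\mathrm{Aut}(G)$, $y^\alpha$ denotes the image of $y$ under $\alpha$. Generalized Cayley graphs: given a finite group $G$, an automorphism $\alpha\in\mathrm{Aut}(G)$ and $S\subseteq G$, suppose (a) $\alpha^2=\mathrm{id}$; (b) for every $y\in G$, $(y^{-1})^\alpha y\notin S$; (c) for all $y,h\in G$, if $(h^{-1})^\alpha y\in S$ then $(y^{-1})^\alpha h\in S$. Then $S$ is called a generalized Cayley subset of $G$ induced by $\alpha$, and $GC(G,S,\alpha)$ is the graph with vertex set $G$ and edge set $\{\{y,h\}\mid (y^{-1})^\alpha h\in S\}$. Writing $GC(G,S,\alpha)$ includes the assertion that $S$ is a generalized Cayley subset induced by $\alpha$. $\omega_\alpha(G)=\{(y^{-1})^\alpha y\mid y\in G\}$ and $\Omega_\alpha(G)=\{y\in G\mid y^\alpha=y^{-1},\ y\notin\omega_\alpha(G)\}$. *)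

(* Defs.v *)
From mathcomp Require Import all_boot all_fingroup all_solvable.

Set Implicit Arguments.
Unset Strict Implicit.
Unset Printing Implicit Defensive.

Import GroupScope.

(* Finite simple graphs whose vertices are drawn from an ambient finite type:
   edges are unordered pairs of distinct vertices. *)
Record sgraph (T : finType) := SGraph {
  vertices : {set T};
  edges : {set {set T}};
  edges_subset : forall e, e \in edges -> e \subset vertices;
  edges_card : forall e, e \in edges -> #|e| = 2
}.

(* Only the values of f on the vertices of X matter. *)
Definition graph_iso (T U : finType) (X : sgraph T) (Y : sgraph U) : Prop :=
  exists f : T -> U,
    [/\ {in vertices X &, injective f},
        f @: vertices X = vertices Y
      & {in vertices X &, forall u v,
          ([set u; v] \in edges X) = ([set f u; f v] \in edges Y)}].

Section GeneralizedCayley.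

Variables (gT : finGroupType) (G : {group gT}).

(* In a finite group G : {group gT}, an element of Aut G is a permutation of gT
   supported on G; the image y^alpha is written alpha y. *)

Definition Inn : {set {perm gT}} := conj_aut G @* G.

Definition complete_group : Prop := 'Z(G) = 1 /\ Aut G = Inn.

(* conj_aut G z maps h to h ^ z = z^-1 * h * z, hence the inverse below. *)
Definition sigma (g : gT) : {perm gT} := conj_aut G g^-1.

Lemma sigmaE (g : gT) : g \in G -> {in G, forall h, sigma g h = g * h * g^-1}.
Proof.
move=> Gg h Gh; rewrite /sigma conj_autE ?groupV //.
by rewrite conjgE invgK mulgA.
Qed.

Variable alpha : {perm gT}.

Definition omega : {set gT} := [set alpha y^-1 * y | y in G].

Definition Omega : {set gT} :=
  [set y in G | (alpha y == y^-1) && (y \notin omega)].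

Record gen_cayley_subset (S : {set gT}) : Prop := GenCayleySubset {
  gcs_aut : alpha \in Aut G;
  gcs_subset : S \subset G;
  gcs_invol : alpha ^+ 2 = 1;
  gcs_irrefl : {in G, forall y, alpha y^-1 * y \notin S};
  gcs_sym : {in G &, forall y h, alpha h^-1 * y \in S -> alpha y^-1 * h \in S}
}.

Definition GC_edges (S : {set gT}) : {set {set gT}} :=
  [set [set y; h] | y in G, h in G & alpha y^-1 * h \in S].

Lemma GC_edges_subset (S : {set gT}) (e : {set gT}) :
  e \in GC_edges S -> e \subset G.
Proof.
case/imset2P=> y h Gy; rewrite inE => /andP[Gh _] ->.
by rewrite subUset !sub1set Gy.
Qed.

Lemma GC_edges_card (S : {set gT}) : gen_cayley_subset S ->
  forall e : {set gT}, e \in GC_edges S -> #|e| = 2.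
Proof.
move=> gS e /imset2P[y h Gy]; rewrite inE => /andP[Gh Syh] ->.
rewrite cards2; case: eqP => // eq_yh.
by case/negP: (gcs_irrefl gS Gy); rewrite {2}eq_yh.
Qed.

Definition GC (S : {set gT}) (gS : gen_cayley_subset S) : sgraph gT :=
  SGraph (@GC_edges_subset S) (GC_edges_card gS).

End GeneralizedCayley.

(* Main.v *)
Require Import Defs.
From mathcomp Require Import all_boot all_fingroup all_solvable.

Set Implicit Arguments.
Unset Strict Implicit.
Unset Printing Implicit Defensive.

Import GroupScope.

(** If [alpha] inverts [x], then right translation by [x] turns
    [alpha (y^-1) * h] into [x * (alpha (y^-1) * h) * x]; it is therefore an
    isomorphism from GC(G, S, alpha) to GC(G, xSx, alpha). *)

Lemma aut_rtransl (gT : finGroupType) (G : {group gT}) (alpha : {perm gT})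
    (x y h : gT) :
  alpha \in Aut G -> x \in G -> alpha x = x^-1 -> y \in G ->
  alpha (y * x)^-1 * (h * x) = x * (alpha y^-1 * h) * x.
Proof.
move=> Aa Gx ax Gy; rewrite invMg -(autmE Aa) morphM ?groupV //=.
(* Here [alpha x^-1 = (alpha x)^-1 = x], which is the left factor [x]. *)
by rewrite (morphV (autm Aa)) //= autmE ax invgK !mulgA.
Qed.

Lemma mem_sandwich (gT : finGroupType) (S : {set gT}) (x t : gT) :
  (x * t * x \in [set x * s * x | s in S]) = (t \in S).
Proof. by rewrite (mem_imset _ _ (inj_comp (mulIg x) (mulgI x))). Qed.

(** Each condition on [xSx] at [y], [h] is the same condition on [S] at [y * x^-1], [h * x^-1]. *)
Lemma gen_cayley_sandwich (gT : finGroupType) (G : {group gT})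
    (alpha : {perm gT}) (S : {set gT}) (x : gT) :
  gen_cayley_subset G alpha S -> x \in G -> alpha x = x^-1 ->
  gen_cayley_subset G alpha [set x * s * x | s in S].
Proof.
case=> Aa sSG a2 irrS symS Gx ax.
have Gdiv y : y \in G -> y * x^-1 \in G by move=> Gy; rewrite groupM ?groupV.
have shift y h : y \in G ->
    (alpha y^-1 * h \in [set x * s * x | s in S])
      = (alpha (y * x^-1)^-1 * (h * x^-1) \in S).
  move=> Gy; rewrite -{1}(mulgKV x y) -{1}(mulgKV x h).
  by rewrite (aut_rtransl _ Aa Gx ax (Gdiv y Gy)) mem_sandwich.
split=> //.
- by apply/subsetP=> _ /imsetP[s Ss ->]; rewrite !groupM // (subsetP sSG).
- by move=> y Gy; rewrite shift ?irrS ?Gdiv.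
- by move=> y h Gy Gh; rewrite !shift //; apply: symS; apply: Gdiv.
Qed.

(** An unordered pair may be presented as an edge in either order; the symmetry of [S] makes the
    choice harmless. *)
Lemma mem_GC_edges (gT : finGroupType) (G : {group gT}) (alpha : {perm gT})
    (S : {set gT}) (y h : gT) :
  gen_cayley_subset G alpha S -> y \in G -> h \in G ->
  ([set y; h] \in GC_edges G alpha S) = (alpha y^-1 * h \in S).
Proof.
move=> gS Gy Gh; apply/idP/idP => [/imset2P[u v Gu] | Syh]; last first.
  by apply/imset2P; exists y h; rewrite // inE Gh.
rewrite inE => /andP[Gv Suv] /setP eq_yh_uv.
have := eq_yh_uv v; have := eq_yh_uv u; have := eq_yh_uv h.
have := eq_yh_uv y; rewrite !inE !eqxx ?orbT /= => /esym /orP[]/eqP-> {eq_yh_uv}.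
  (* Case [y = u]: either [v = h], or [v = u], a loop excluded by irreflexivity. *)
  move=> _ _; rewrite eq_sym; case/orP=> /eqP eq_v; last by rewrite -eq_v.
  by have := gcs_irrefl gS Gu; rewrite {2}eq_v Suv.
(* Case [y = v]: the pair is reversed, so [u = h] calls for symmetry; [u = v] is again a loop. *)
move=> _; case/orP=> /eqP eq_u _; last by rewrite -eq_u (gcs_sym gS).
by have := gcs_irrefl gS Gu; rewrite {2}eq_u Suv.
Qed.

Lemma GC_sandwich_iso (gT : finGroupType) (G : {group gT}) (alpha : {perm gT})
    (S : {set gT}) (x : gT) (gS : gen_cayley_subset G alpha S)
    (gxSx : gen_cayley_subset G alpha [set x * s * x | s in S]) :
  x \in G -> alpha x = x^-1 -> graph_iso (GC gS) (GC gxSx).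
Proof.
move=> Gx ax; exists (mulg^~ x); split=> /=.
- by move=> y h _ _; apply: mulIg.
(* The image of the vertex set is the right coset of [G] by [x], which is [G] since [x] lies in
   [G]. *)
- by rewrite -[LHS]/(rcoset G x) rcosetE rcoset_id.
- move=> y h Gy Gh; rewrite !mem_GC_edges ?groupM //.
  by rewrite (aut_rtransl _ (gcs_aut gS) Gx ax Gy) mem_sandwich.
Qed.

Theorem theorem3p3 (gT : finGroupType) (G : {group gT}) (g : gT)
    (S : {set gT}) (Gcomplete : complete_group G)
    (Gg : g \in G) (og : #[g] = 2)
    (gS : gen_cayley_subset G (sigma G g) S)
    (x : gT) (Ox : x \in Omega G (sigma G g)) :
  exists gxSx : gen_cayley_subset G (sigma G g) [set x * s * x | s in S],
    graph_iso (GC gS) (GC gxSx).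
Proof.
(* Membership in [Omega] provides the inversion of [x] by [sigma G g]. *)
move: Ox; rewrite inE => /and3P[Gx /eqP ax _].
by exists (gen_cayley_sandwich gS Gx ax); apply: GC_sandwich_iso.
Qed.
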